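(* Let $n = 2t+1$ and let $C[n,1]$ be an $(n,1,n)$ MRD code over $GF(2^n)$, i.e. a one-dimensional $GF(2^n)$-linear code of length $n$ with minimum rank distance $n$. Let $x=(x_1,\dots,x_n)$ be the transmitted codeword, $x \neq 0$, and let $y=(y_1,\dots,y_n)$ be the received vector in which $t$ coordinates are erasures, denoted $*_1,\dots,*_t$, and the remaining $n-t$ coordinates agree with those of $x$. Then, for every $s$ with $0\le s$ and $s+1 \le t$, once $*_1,\dots,*_s$ have been chosen by the guessing process, the element $*_{s+1}$ can be chosen by the guessing process in exactly $2^{\,n-t+s}\,[\,2^{\,t-s}-1\,]$ ways.
   Context: For $x=(x_1,\dots,x_n)\in GF(2^n)^n$, the rank $r(x)$ is the rank over $GF(2)$ of the $n\times n$ matrix whose $i$-th column is the coordinate vector of $x_i$ with respect to a fixed basis of $GF(2^n)$ over $GF(2)$; equivalently, the maximum number of coordinates of $x$ that are linearly independent over $GF(2)$. The rank distance is $d_R(x,y)=r(x-y)$, and the minimum distance of a linear code is the minimum of $r(x)$ over its nonzero codewords. An $(n,k,d)$ linear code over $GF(2^N)$, $n\le N$, is MRD if $d=n-k+1$. An erasure is a coordinate of the received vector that is left blank. Guessing process: label the coordinates so that the erased ones are the first $t$ and the unerased ones are $y_{t+1},\dots,y_n$. Choose successively elements $*_1,*_2,\dots,*_t\in GF(2^n)$ to fill the blanks so that, for each $s=0,\dots,t-1$, $*_{s+1}\neq 0$ and the set $\{*_{s+1},*_1,\dots,*_s,y_{t+1},\dots,y_n\}$ (of $n-t+s+1$ elements)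 is linearly independent over $GF(2)$. *)

(* Defs.v *)
From HB Require Import structures.
From mathcomp Require Import all_boot all_order all_fingroup all_algebra all_solvable all_field.

Set Implicit Arguments.
Unset Strict Implicit.
Unset Printing Implicit Defensive.

Import GRing.Theory.
Local Open Scope ring_scope.

(* GF(2^N) is a field extension L of 'F_2 with \dim {:L} = N; an 'F_2-basis of
   L is an N-tuple e with basis_of {:L} e. *)

Definition rank_vec (L : fieldExtType 'F_2) (N n : nat) (e : N.-tuple L)
    (x : 'rV[L]_n) : nat :=
  \rank (\matrix_(i < N, j < n) coord e i (x 0 j)).

Definition min_rank_distance (L : fieldExtType 'F_2) (N n : nat)
    (e : N.-tuple L) (C : {vspace 'rV[L]_n}) (d : nat) : Prop :=
  (exists c : 'rV[L]_n, [/\ c \in C, c != 0 & rank_vec e c = d]) /\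
  (forall c : 'rV[L]_n, c \in C -> c != 0 -> (d <= rank_vec e c)%N).

Definition linear_code (L : fieldExtType 'F_2) (N n : nat) (e : N.-tuple L)
    (k d : nat) (C : {vspace 'rV[L]_n}) : Prop :=
  \dim C = k /\ min_rank_distance e C d.

Definition MRD_code (L : fieldExtType 'F_2) (N n : nat) (e : N.-tuple L)
    (k d : nat) (C : {vspace 'rV[L]_n}) : Prop :=
  [/\ (n <= N)%N, linear_code e k d C & d = (n - k + 1)%N].

(* A received word is y : 'I_n -> option L, with None marking an erasure. *)

Definition erasures (L : fieldExtType 'F_2) (n : nat)
    (y : 'I_n -> option L) : {set 'I_n} := [set i | y i == None].

Definition agrees_off_erasures (L : fieldExtType 'F_2) (n : nat)
    (x : 'rV[L]_n) (y : 'I_n -> option L) : Prop :=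
  forall i : 'I_n, i \notin erasures y -> y i = Some (x 0 i).

(* The unerased symbols, one entry per unerased coordinate.  Relabelling the
   coordinates only permutes this list, which does not affect freeness. *)
Definition unerased (L : fieldExtType 'F_2) (n : nat)
    (y : 'I_n -> option L) : seq L := pmap y (enum 'I_n).

(* [free] on a sequence also forces its entries to be pairwise distinct. *)
Definition admissible (L : fieldExtType 'F_2) (n : nat)
    (y : 'I_n -> option L) (g : seq L) (a : L) : bool :=
  (a != 0) && free (a :: g ++ unerased y).

Definition guessed (L : fieldExtType 'F_2) (n : nat)
    (y : 'I_n -> option L) (g : seq L) : Prop :=
  forall i : nat, (i < size g)%N -> admissible y (take i g) (nth 0 g i).

(* Main.v *)
(* Full rank distance makes the coordinates of a nonzero codeword a free family
   over GF(2).  Hence the unerased symbols and the guesses made so far span a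
   subspace of dimension n - t + s, and the admissible next guesses are exactly
   the elements outside it: 2 ^ n - 2 ^ (n - t + s) of them. *)

Require Import Defs.
From HB Require Import structures.
From mathcomp Require Import all_boot all_order all_fingroup all_algebra all_solvable all_field.

Set Implicit Arguments.
Unset Strict Implicit.
Unset Printing Implicit Defensive.

Import GRing.Theory.
Local Open Scope ring_scope.

(** Applying each coordinate function of [e] to a GF(2)-relation among the entries of [x] puts its
    coefficient vector in the kernel of the coordinate matrix, which is trivial at full column
    rank. *)
Lemma full_rank_vec_free (L : fieldExtType 'F_2) (N n : nat) (e : N.-tuple L)
    (x : 'rV[L]_n) :
  (n <= rank_vec e x)%N -> free [seq x 0 i | i <- enum 'I_n].
Proof.
rewrite /rank_vec; set M := \matrix_(i, j) _ => le_n_rkM.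
have freeMT : row_free M^T.
  by rewrite /row_free mxrank_tr eqn_leq rank_leq_col.
rewrite -val_ord_tuple; apply/(@freeP _ _ _ [tuple x 0 i | i < n]) => k sum0 j.
suff /rowP/(_ j) : \row_i k i = 0 by rewrite !mxE.
apply/eqP; rewrite -(mulmx_free_eq0 _ freeMT); apply/eqP/rowP => i.
rewrite !mxE -[RHS](linear0 (coord e i)) -sum0 linear_sum.
apply: eq_bigr => l _; rewrite linearZ !mxE /=.
by rewrite -[X in X`__](erefl (tval [tuple x 0 i | i < n])) -tnth_nth tnth_mktuple.
Qed.

Lemma unerasedE (L : fieldExtType 'F_2) (n : nat) (x : 'rV[L]_n)
    (y : 'I_n -> option L) :
  agrees_off_erasures x y ->
  unerased y = [seq x 0 i | i <- enum 'I_n & i \notin erasures y].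
Proof.
move=> agree; rewrite /unerased; elim: (enum 'I_n) => //= i r ->.
case: ifP => [/agree -> // | /negbFE].
by rewrite inE => /eqP ->.
Qed.

Lemma size_unerased (L : fieldExtType 'F_2) (n : nat) (x : 'rV[L]_n)
    (y : 'I_n -> option L) :
  agrees_off_erasures x y -> size (unerased y) = (n - #|erasures y|)%N.
Proof.
move=> /unerasedE ->; rewrite size_map -[X in (X - _)%N]card_ord.
rewrite -(cardsC (erasures y)) addKn cardE !enumT.
by rewrite /enum_mem; congr size; apply: eq_filter => i; rewrite /= in_setC.
Qed.

Lemma free_unerased (L : fieldExtType 'F_2) (n : nat) (x : 'rV[L]_n)
    (y : 'I_n -> option L) :
  agrees_off_erasures x y -> free [seq x 0 i | i <- enum 'I_n] ->
  free (unerased y).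
Proof.
move=> /unerasedE ->.
(* Permuting the unerased coordinates to the front makes their symbols a prefix of a free family. *)
have /(perm_map (fun i => x 0 i))/perm_free <- :=
  permEl (perm_filterC (fun i => i \notin erasures y) (enum 'I_n)).
by rewrite map_cat => /catl_free.
Qed.

(** Admissibility of the last guess already speaks of the whole family, so splitting off that guess
    suffices, with no induction hypothesis. *)
Lemma free_guessed (L : fieldExtType 'F_2) (n : nat) (y : 'I_n -> option L)
    (g : seq L) :
  free (unerased y) -> guessed y g -> free (g ++ unerased y).
Proof.
move=> free_u; elim/last_ind: g => [// | g a _] /(_ (size g)).
rewrite size_rcons ltnS leqnn => /(_ isT) /andP[_].
rewrite nth_rcons ltnn eqxx -cats1 take_size_cat // => free_ag.
by rewrite -catA cat1s (perm_free (permEl (perm_catCA g [:: a] (unerased y)))).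
Qed.

Lemma card_admissible (L : fieldExtType 'F_2) (n : nat) (y : 'I_n -> option L)
    (g : seq L) :
  free (g ++ unerased y) ->
  #|[set a : finvect_type L | admissible y g a]|
    = (2 ^ \dim {:L} - 2 ^ size (g ++ unerased y))%N.
Proof.
move=> free_gu; set V : {vspace finvect_type L} := <<g ++ unerased y>>%VS.
have -> : [set a : finvect_type L | admissible y g a] = ~: [set a in V].
  apply/setP => a; rewrite !inE /admissible free_cons free_gu andbT.
  (* At [a = 0] both sides are false, since 0 lies in the span. *)
  by case: eqVneq => [-> | //]; rewrite mem0v.
rewrite cardsCs setCK cardsE.
(* Seen as its own full subspace, the ambient space is counted by [card_vspace], just like [V]. *)
have -> : #|finvect_type L| = #|{: finvect_type L}%VS|.
  by apply/esym/eq_card => v; rewrite memvf.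
rewrite !card_vspace card_Fp //.
by have /eqP -> : free (g ++ unerased y) by [].
Qed.

Theorem theorem3p3p1 (n t : nat) (L : fieldExtType 'F_2) (e : n.-tuple L)
    (C : {vspace 'rV[L]_n}) (x : 'rV[L]_n) (y : 'I_n -> option L)
    (hn : n = (2 * t + 1)%N)
    (hL : \dim {:L} = n)
    (he : basis_of {:L} e)
    (hC : MRD_code e 1 n C)
    (hxC : x \in C)
    (hx0 : x != 0)
    (hyt : #|erasures y| = t)
    (hyx : agrees_off_erasures x y) :
  forall s : nat, (s.+1 <= t)%N ->
  forall g : s.-tuple L, guessed y g ->
    #|[set a : finvect_type L | admissible y g a]|
      = (2 ^ (n - t + s) * (2 ^ (t - s) - 1))%N.
Proof.
move=> s lt_st g guess_g.
case: hC => _ [_ [_ /(_ x hxC hx0) /full_rank_vec_free free_x]] _.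
have free_gu := free_guessed (free_unerased hyx free_x) guess_g.
rewrite (card_admissible free_gu) hL size_cat size_tuple (size_unerased hyx) hyt.
(* These two bounds keep the truncated subtractions exact: [(n - t + s) + (t - s)] is [n], so the
   product expands to [2 ^ n - 2 ^ (n - t + s)]. *)
have le_st := ltnW lt_st.
have le_tn : (t <= n)%N by rewrite hn mul2n -addnn -addnA leq_addr.
by rewrite mulnBr muln1 -expnD [(s + _)%N]addnC -[in RHS]addnA subnKC // subnK.
Qed.
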